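(* For every $\gamma>0$ there is a constant $k=k(\gamma)>0$ such that the following holds. Let $S$ be an infinite $\gamma$-bounded connected network, i.e. $\gamma<c(e)<\gamma^{-1}$ and $\gamma<\pi(x)<\gamma^{-1}$ for every vertex $x$ and edge $e$ of $S$. Then for any $x\in S$ and any $Z\subset S$ with $B_2(x)\cap Z=\emptyset$, $$E_x\left[\tau_Z\right]>k\,\frac{G_Z^2}{\log G_Z},$$ where $G_Z=G_Z(x)$.
   Context: A network is a graph $S$ in which each edge $e$ is assigned a conductance $c(e)$; $\pi(x)$ is the sum of $c(e)$ over all edges $e$ having $x$ as an endpoint. $X(t)$, $t=0,1,2,\dots$, is the discrete time simple random walk on the network: from $x$ it moves to a neighbor connected to $x$ by the edge $e$ with probability $c(e)/\pi(x)$. $E_x$ is expectation for the walk started at $x$. $\tau_Z=\inf\{t\ge0:X(t)\in Z\}$ is the first hitting time of $Z$. $G_Z(x)=E_x\left[\sum_{t=0}^{\tau_Z}\mathbf{1}_{\{X(t)=x\}}\right]$ is the expected number of visits to $x$ of a walk starting at $x$ before $\tau_Z$. $B_r(x)=\{v\in S: d_S(v,x)<r\}$, where $d_S$ is graph distance in $S$. In the degenerate case $G_Z=\infty$ (possible only for $Z=\emptyset$) the inequality is read as $E_x[\tau_Z]=\infty$. *)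

(* Defs.v *)
From HB Require Import structures.
From mathcomp Require Import all_boot all_order all_algebra.
From mathcomp Require Import all_classical all_reals all_analysis.

Set Implicit Arguments.
Unset Strict Implicit.
Unset Printing Implicit Defensive.

Import Order.TTheory GRing.Theory Num.Theory.
Import numFieldNormedType.Exports.

Local Open Scope classical_set_scope.
Local Open Scope ring_scope.

(* An undirected graph, possibly with parallel edges and loops: [src] and [tgt]
   list the two endpoints of an edge in an arbitrary order, and the definitions
   below do not depend on that order. *)
Record network (R : realType) := Network {
  vertex : choiceType;
  edge : choiceType;
  src : edge -> vertex;
  tgt : edge -> vertex;
  cond : edge -> R;
  cond_gt0 : forall e, 0 < cond e
}.

Section Graph.
Context {R : realType} {S : network R}.
Implicit Types (x y : vertex S) (e : edge S).

Definition endpoint e x : Prop := src e = x \/ tgt e = x.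

Definition joins e x y : Prop :=
  (src e = x /\ tgt e = y) \/ (src e = y /\ tgt e = x).

Definition adjacent x y : Prop := exists e, joins e x y.

Definition walk_between (n : nat) x y : Prop :=
  exists u : nat -> vertex S,
    [/\ u 0%N = x, u n = y &
        forall i, (i < n)%N -> adjacent (u i) (u i.+1)].

Definition dist x y : \bar R :=
  ereal_inf [set n%:R%:E | n in [set n | walk_between n x y]].

Definition Ball (r : R) x : set (vertex S) := [set v | (dist v x < r%:E)%E].

(* The value is a priori extended, since a vertex may have infinitely many
   edges; a loop at [x] is counted once. *)
Definition vweight x : \bar R :=
  (\esum_(e in [set e | endpoint e x]) (cond e)%:E)%E.

(* The walk crosses an edge [e] at [x] with probability c(e)/pi(x), so the
   probability to go from [x] to [y] sums over the edges joining them. *)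
Definition transition x y : R :=
  fine (\esum_(e in [set e | joins e x y]) (cond e)%:E)%E / fine (vweight x).

End Graph.

Definition connected_network (R : realType) (S : network R) : Prop :=
  forall x y : vertex S, exists n, walk_between n x y.

Definition infinite_network (R : realType) (S : network R) : Prop :=
  infinite_set [set: vertex S].

Definition bounded_network (R : realType) (gamma : R) (S : network R) : Prop :=
  (forall e : edge S, gamma < cond e < gamma^-1) /\
  (forall x : vertex S, (gamma%:E < vweight x < (gamma^-1)%:E)%E).

Section Walk.
Context {R : realType} {S : network R}.
Context {d : measure_display} {T : measurableType d}.

(* The Markov property is required on the cylinders of the past; this
   determines the law of the whole trajectory. *)
Record random_walk (P : probability T R) (x : vertex S)
    (X : nat -> T -> vertex S) : Prop := RandomWalk {
  rw_measurable : forall t v, measurable [set w | X t w = v];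
  rw_start : P [set w | X 0%N w = x] = 1%E;
  rw_step : forall (t : nat) (u : nat -> vertex S),
    P [set w | forall i, (i <= t.+1)%N -> X i w = u i] =
    (P [set w | forall i, (i <= t)%N -> X i w = u i] *
     (transition (u t) (u t.+1))%:E)%E
}.

Definition hitting_time (X : nat -> T -> vertex S) (Z : set (vertex S))
    (w : T) : \bar R :=
  ereal_inf [set t%:R%:E | t in [set t | Z (X t w)]].

Definition expected_hitting_time (P : probability T R)
    (X : nat -> T -> vertex S) (Z : set (vertex S)) : \bar R :=
  (\int[P]_w hitting_time X Z w)%E.

(* [G_Z(x)] when [X] is a random walk started at [x] under [P] *)
Definition green (P : probability T R) (X : nat -> T -> vertex S)
    (Z : set (vertex S)) (x : vertex S) : \bar R :=
  (\int[P]_w \sum_(t <oo | (t%:R%:E <= hitting_time X Z w)%E)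
     (\1_[set x] (X t w))%:E)%E.

End Walk.

(* Main.v *)
Require Import Defs.
From HB Require Import structures.
From mathcomp Require Import all_boot all_order all_algebra.
From mathcomp Require Import all_classical all_reals all_analysis.
From mathcomp Require Import measurable_realfun zify ring lra.

Set Implicit Arguments.
Unset Strict Implicit.
Unset Printing Implicit Defensive.

Import Order.TTheory GRing.Theory Num.Theory.
Import numFieldNormedType.Exports.

Local Open Scope classical_set_scope.
Local Open Scope ring_scope.

(* Let [u y] be the expected number of visits to [y] before hitting [Z], divided
   by [pi(y)]. By reversibility [u] is the voltage of a unit current flowing from
   [x] to [Z]; at most one unit crosses any edge, so [u] varies by at most
   [1/gamma] along an edge. As the network is infinite and locally
   finite, there is a geodesic from [x] of length about [gamma u(x) / 2], on
   which [u >= u(x) / 2], and summing [pi u] over it bounds the expected hitting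
   time below by a multiple of [u(x)^2], hence of [G_Z^2], even without the
   logarithm. Since [x] and its neighbors avoid [Z], a return to [x] in two steps
   gives [G_Z >= 1 + gamma^4], so [log G_Z] is bounded away from [0].
   All estimates are made for the visits during the first [n] steps, for which
   the superlevel sets of [u] are finite and no integrability is needed. *)

(** * Finite sums and the flow out of a superlevel set *)

Lemma ler_sum_uniq (R : numDomainType) (V : eqType) (s1 s2 : seq V)
    (F : V -> R) :
  uniq s1 -> {subset s1 <= s2} -> (forall v, 0 <= F v) ->
  \sum_(v <- s1) F v <= \sum_(v <- s2) F v.
Proof.
move=> + + F0; elim: s1 s2 => [|a s1 ih] s2 /=.
  by move=> _ _; rewrite big_nil sumr_ge0.
move=> /andP[as1 us1] s12; have as2 : a \in s2 by apply: s12; rewrite mem_head.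
rewrite big_cons (perm_big _ (perm_to_rem as2)) big_cons lerD2l; apply: ih => //.
move=> v vs1; have := s12 v; rewrite inE vs1 orbT => /(_ isT).
rewrite (perm_mem (perm_to_rem as2)) inE => /predU1P[va|//].
by rewrite -va vs1 in as1.
Qed.

Lemma sum_pred1_le1 (R : numDomainType) (V : eqType) (s : seq V) (p : pred V) :
  uniq s -> {in s &, forall v w, p v -> p w -> v = w} ->
  \sum_(v <- s) (p v)%:R <= 1 :> R.
Proof.
elim: s => [|a s ih] /=; first by rewrite big_nil ler01.
move=> /andP[as_ us] pP; rewrite big_cons; have [pa|_] := boolP (p a); last first.
  rewrite add0r ih// => v w vs ws; apply: pP; by rewrite inE ?vs ?ws orbT.
rewrite big_seq big1 ?addr0// => v vs.
have [pv|//] := boolP (p v).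
have va : v = a by apply: pP => //; rewrite inE ?vs ?eqxx ?orbT.
by rewrite -va vs in as_.
Qed.

(** Infinitely many values at least [b] would provide more than [M / b] of them, whose sum exceeds
    [M]. *)
Lemma finite_set_sum_le (R : realType) (V : choiceType) (F : V -> R) (b M : R) :
  0 < b -> (forall s, uniq s -> \sum_(v <- s) F v <= M) ->
  finite_set [set v | b <= F v].
Proof.
move=> b0 FM; apply: contrapT => /(infinite_set_fset (Num.truncn (M / b)).+1).
move=> [B BF cB]; suff : M < \sum_(v <- finmap.enum_fset B) F v.
  by rewrite ltNge FM// finmap.fset_uniq.
apply: (@lt_le_trans _ _ (\sum_(v <- finmap.enum_fset B) b)).
  rewrite big_const_seq iter_addr addr0 count_predT -mulr_natl -ltr_pdivrMr//.
  by apply: (lt_le_trans (truncnS_gt _)); rewrite ler_nat.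
by rewrite big_seq [leRHS]big_seq; apply: ler_sum => v vB; exact: BF.
Qed.

(* Sum the inequality over the superlevel set [A]: the edges inside [A] cancel,
   so the total flow leaving [A] is at most the unit source at [x]. *)
Lemma superlevel_flow_le1 (R : numDomainType) (V : eqType) (C : V -> V -> R)
    (p u : V -> R) (N : V -> seq V) (x y z : V) (A : seq V) :
  uniq A -> (forall v w, C v w = C w v) -> (forall v w, 0 <= C v w) ->
  (forall v s, uniq s -> \sum_(w <- s) C v w <= p v) -> (forall v, 0 <= u v) ->
  (forall v, uniq (N v)) ->
  (forall v, p v * u v <= (v == x)%:R + \sum_(w <- N v) C v w * u w) ->
  (forall v w, v \in A -> w \notin A -> u w <= u v) ->
  y \in A -> z \notin A -> C y z * (u y - u z) <= 1.
Proof.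
move=> uA Csym C0 Cp u0 uN pu Aup yA zA.
(* [s'] collects [z] and all neighbors of [A] outside [A], so that [A ++ s'] contains [N v] for
   every [v] in [A]. *)
set s' := [seq w <- undup (z :: flatten (map N A)) | w \notin A].
have us : uniq (A ++ s').
  rewrite cat_uniq uA filter_uniq ?undup_uniq// andbT.
  by apply/hasPn => w; rewrite mem_filter => /andP[].
have zs' : z \in s' by rewrite mem_filter zA mem_undup mem_head.
have Ns v : v \in A -> {subset N v <= A ++ s'}.
  move=> vA w wN; rewrite mem_cat mem_filter mem_undup.
  case: (w \in A) => //=; rewrite inE; apply/orP; right.
  by apply/flattenP; exists (N v) => //; exact: map_f.
have s'P w : w \in s' -> w \notin A by rewrite mem_filter => /andP[].
have flow : \sum_(v <- A) \sum_(w <- A ++ s') C v w * (u v - u w) <= 1.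
  apply: (@le_trans _ _ (\sum_(v <- A) (v == x)%:R)); last first.
    by apply: sum_pred1_le1 => // v w _ _ /eqP-> /eqP->.
  rewrite big_seq [leRHS]big_seq; apply: ler_sum => v vA.
  under eq_bigr do rewrite mulrBr; rewrite sumrB -mulr_suml lerBlDr.
  apply: (le_trans (ler_wpM2r (u0 v) (Cp v _ us))); apply: (le_trans (pu v)).
  rewrite lerD2l; apply: ler_sum_uniq => //; first exact: Ns.
  by move=> w; rewrite mulr_ge0.
have inner : \sum_(v <- A) \sum_(w <- A) C v w * (u v - u w) = 0.
  under eq_bigr do under eq_bigr do rewrite mulrBr.
  under eq_bigr do rewrite sumrB; rewrite sumrB [X in _ - X]exchange_big/=.
  apply/eqP; rewrite subr_eq0; apply/eqP; apply: eq_bigr => v _.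
  by apply: eq_bigr => w _; rewrite Csym.
(* The pair [(y, z)] is one term of the flow out of [A]; all other terms are nonnegative. *)
apply: le_trans flow; under eq_bigr do rewrite big_cat/=.
rewrite big_split/= inner add0r (perm_big _ (perm_to_rem yA)) big_cons.
rewrite (perm_big _ (perm_to_rem zs')) big_cons/= -addrA lerDl addr_ge0//.
  rewrite big_seq sumr_ge0// => w /mem_rem/s'P wA.
  by rewrite mulr_ge0// subr_ge0 Aup.
rewrite big_seq sumr_ge0// => v /mem_rem vA; rewrite big_seq sumr_ge0// => w /s'P wA.
by rewrite mulr_ge0// subr_ge0 Aup.
Qed.

(** * Conductances of a bounded network *)

(** Every [B] is summed over the index list of [A], so that sums over edges and over vertices can be
    exchanged. *)
Lemma fine_esum_sub (R : realType) (E : choiceType) (A B : set E) (c : E -> R) :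
  finite_set A -> B `<=` A -> (forall e, 0 <= c e) ->
  fine (\esum_(e in B) (c e)%:E)%E =
  \sum_(e <- finmap.enum_fset (fset_set A) | e \in B) c e.
Proof.
move=> fA BA c0; have fB : finite_set B by exact: sub_finite_set fA.
rewrite esum_fset//; last by move=> e _; rewrite lee_fin.
rewrite fsbig_finite//= sumEFin/= -[RHS]big_filter; apply: perm_big.
apply: uniq_perm; rewrite ?filter_uniq ?finmap.fset_uniq// => e.
rewrite mem_filter !in_fset_set//; apply/idP/andP => [eB|[]//].
by split=> //; exact/mem_set/BA/set_mem.
Qed.

Section Conductance.
Context (R : realType) (gamma : R) (gamma_gt0 : 0 < gamma) (S : network R).
Hypothesis bS : bounded_network gamma S.
Implicit Types (v w : vertex S) (e : edge S).

Definition conductance v w : R :=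
  fine (\esum_(e in [set e | joins e v w]) (cond e)%:E)%E.

Definition weight v : R := fine (vweight v).

Lemma weightE v : vweight v = (weight v)%:E.
Proof.
have /andP[h1 h2] := bS.2 v; rewrite /weight fineK// ge0_fin_numE.
  exact: lt_le_trans h2 (leey _).
by apply: ltW; apply: lt_trans h1; rewrite lte_fin.
Qed.

Lemma weight_bounds v : gamma < weight v < gamma^-1.
Proof. by have := bS.2 v; rewrite weightE !lte_fin. Qed.

Lemma weight_gt0 v : 0 < weight v.
Proof. by have /andP[h _] := weight_bounds v; exact: lt_trans h. Qed.

Lemma cond_gt e : gamma < cond e.
Proof. by have /andP[] := bS.1 e. Qed.

Let cond_ge0 e : 0 <= cond e.
Proof. exact/ltW/cond_gt0. Qed.

(** Each edge at [v] takes more than [gamma] of the finite weight of [v]. *)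
Lemma finite_endpoint v : finite_set [set e | endpoint e v].
Proof.
pose F e := if `[< endpoint e v >] then cond e else 0.
have -> : [set e | endpoint e v] = [set e | gamma <= F e].
  apply/seteqP; split=> e /=; rewrite /F; first by move/asboolT ->; exact/ltW/cond_gt.
  by case: asboolP => // _; rewrite leNgt gamma_gt0.
apply: (finite_set_sum_le (M := weight v)) => // s us.
rewrite -big_mkcond/= -lee_fin -weightE /vweight -big_filter -sumEFin.
apply: esum_ge; exists [set` [seq e <- s | `[< endpoint e v >]]].
  by split=> // e /=; rewrite mem_filter => /andP[/asboolP].
by rewrite -fsbig_seq// filter_uniq.
Qed.

Let edges v := finmap.enum_fset (fset_set [set e | endpoint e v]).

Lemma weight_sum v : weight v = \sum_(e <- edges v) cond e.
Proof.
rewrite /weight /vweight (fine_esum_sub (finite_endpoint v))// [LHS]big_seq_cond.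
rewrite [RHS]big_seq; apply: eq_bigl => e; rewrite andb_idr//.
by rewrite in_fset_set//; exact: finite_endpoint.
Qed.

Lemma joins_endpoint v w : [set e | joins e v w] `<=` [set e | endpoint e v].
Proof. by move=> e [[h _]|[_ h]]; [left|right]. Qed.

Lemma conductance_sum v w :
  conductance v w = \sum_(e <- edges v | `[< joins e v w >]) cond e.
Proof.
rewrite /conductance (fine_esum_sub (finite_endpoint v) (@joins_endpoint v w))//.
Qed.

Lemma conductance_ge0 v w : 0 <= conductance v w.
Proof. by rewrite conductance_sum sumr_ge0. Qed.

Lemma conductanceC v w : conductance v w = conductance w v.
Proof.
congr (fine (esum _ _)); apply/seteqP.
by split=> e /=; rewrite /joins => -[[-> ->]|[-> ->]]; [right|left|right|left].
Qed.

Lemma conductance_adjacent v w : Defs.adjacent v w -> gamma <= conductance v w.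
Proof.
move=> [e evw]; rewrite conductance_sum.
have ev : e \in edges v.
  rewrite in_fset_set ?inE/=; first exact: joins_endpoint evw.
  exact: finite_endpoint.
rewrite (perm_big _ (perm_to_rem ev)) big_cons asboolT//.
by apply: (le_trans (ltW (cond_gt e))); rewrite lerDl sumr_ge0.
Qed.

Lemma conductance_not_adjacent v w : ~ Defs.adjacent v w -> conductance v w = 0.
Proof.
move=> vw; rewrite conductance_sum big_pred0// => e.
by apply/asboolP => evw; apply: vw; exists e.
Qed.

(** An edge at [v], possibly a loop, determines its other endpoint, so after exchanging the sums it
    is counted at most once. *)
Lemma sum_conductance_le v (s : seq (vertex S)) :
  uniq s -> \sum_(w <- s) conductance v w <= weight v.
Proof.
move=> us; under eq_bigr do rewrite conductance_sum big_mkcond/=.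
rewrite exchange_big/= weight_sum; apply: ler_sum => e _.
under eq_bigr do rewrite -mulrb -mulr_natr.
rewrite -mulr_sumr ler_piMr// sum_pred1_le1// => w w' _ _.
by move=> /asboolP[[? ?]|[? ?]] /asboolP[[? ?]|[? ?]]; congruence.
Qed.

Lemma transitionE v w : transition v w = conductance v w / weight v.
Proof. by []. Qed.

Lemma finite_adjacent v : finite_set [set w | Defs.adjacent v w].
Proof.
have -> : [set w | Defs.adjacent v w] = [set w | gamma <= conductance v w].
  apply/seteqP; split=> w /=; first exact: conductance_adjacent.
  move=> h; apply: contrapT => /conductance_not_adjacent vw.
  by move: h; rewrite vw leNgt gamma_gt0.
by apply: (finite_set_sum_le (M := weight v)) => // s; exact: sum_conductance_le.
Qed.

(** [fset_set] is empty on infinite sets; [finite_adjacent] makes this list faithful. *)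
Definition neighbors v : seq (vertex S) :=
  finmap.enum_fset (fset_set [set w | Defs.adjacent v w]).

Lemma neighbors_uniq v : uniq (neighbors v).
Proof. exact: finmap.fset_uniq. Qed.

Lemma mem_neighbors v w : (w \in neighbors v) = `[< Defs.adjacent v w >].
Proof.
rewrite in_fset_set; last exact: finite_adjacent.
by apply/idP/asboolP; rewrite inE.
Qed.

Lemma adjacentC v w : Defs.adjacent v w -> Defs.adjacent w v.
Proof. by move=> [e [h|h]]; exists e; [right|left]. Qed.

Lemma transition_not_neighbor v w : v \notin neighbors w -> transition v w = 0.
Proof.
rewrite mem_neighbors => /asboolPn vw; rewrite transitionE conductanceC.
by rewrite conductance_not_adjacent// mul0r.
Qed.

(** One factor [gamma] comes from the conductance, the other from the inverse of the weight. *)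
Lemma transition_ge v w : Defs.adjacent v w -> gamma ^+ 2 <= transition v w.
Proof.
move=> /conductance_adjacent vw; have /andP[_ h] := weight_bounds v.
rewrite transitionE expr2 ler_pM ?(ltW gamma_gt0)//.
by rewrite -[leLHS]invrK lef_pV2 ?posrE ?invr_gt0 ?weight_gt0// ltW.
Qed.

Lemma finite_walk_end v n : finite_set [set w | walk_between n v w].
Proof.
elim: n => [|n ih].
  by apply: sub_finite_set (finite_set1 v) => w [u [<- <- _]].
apply: (@sub_finite_set _ _
    (\bigcup_(w in [set w | walk_between n v w]) [set w' | Defs.adjacent w w'])).
  move=> w [u [u0 un uadj]]; exists (u n); last first.
    by rewrite -un; exact: uadj.
  by exists u; split=> // i ni; apply: uadj; exact: ltnW.
by apply: bigcup_finite => // w _; exact: finite_adjacent.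
Qed.

Hypothesis cS : connected_network S.

(** By connectedness the vertices are a countable union of finite sets of walk ends. Countability
    makes every event about [X t] measurable, starting from single-vertex events. *)
Lemma vertex_countable (x : vertex S) : countable [set: vertex S].
Proof.
have -> : [set: vertex S] = \bigcup_n [set w | walk_between n x w].
  by apply/seteqP; split=> // w _; have [n] := cS x w; exists n.
apply: bigcup_countable => // n _; apply: finite_set_countable.
exact: finite_walk_end.
Qed.

Hypothesis iS : infinite_network S.

(** Only finitely many vertices are reached in fewer than [m] steps, so some [y] is not. A shortest
    walk to [y] has at least [m] steps and repeats no vertex during the first [m]. *)
Lemma exists_geodesic (x : vertex S) (m : nat) :
  exists u : nat -> vertex S, [/\ u 0%N = x,
    forall i, (i < m)%N -> Defs.adjacent (u i) (u i.+1) &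
    {in [pred i | (i <= m)%N] &, injective u}].
Proof.
have [y ym] : exists y, forall n, (n < m)%N -> ~ walk_between n x y.
  apply: contrapT => h; apply: iS.
  apply: (@sub_finite_set _ _ (\bigcup_(n in `I_m) [set w | walk_between n x w])).
    move=> y _; apply: contrapT => hy; apply: h; exists y => n nm hn; apply: hy.
    by exists n.
  by apply: bigcup_finite => // n _; exact: finite_walk_end.
have yex : exists n, `[< walk_between n x y >].
  by have [n ?] := cS x y; exists n; exact/asboolP.
case: (ex_minnP yex) => L /asboolP[u [u0 uL uadj]] Lmin.
have mL : (m <= L)%N.
  rewrite leqNgt; apply/negP => Lm; apply: (ym _ Lm); by exists u.
have uinj i j : (i < j)%N -> (j <= m)%N -> u i <> u j.
  move=> ij jm uij; have jL := leq_trans jm mL.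
  suff /asboolT/Lmin : walk_between (L - (j - i)) x y by lia.
  (* If [u i = u j], cutting out the loop between times [i] and [j] gives a shorter walk. *)
  exists (fun k => if (k <= i)%N then u k else u (k + (j - i))%N); split => //.
    case: ifP => h; last by rewrite subnK//; lia.
    (* The new end time is at most [i] only when [j = L]. *)
    have -> : (L - (j - i) = i)%N by lia.
    by rewrite uij -uL; congr u; lia.
  move=> k kL; case: ifP => ki; case: ifP => ki1.
  - by apply: uadj; lia.
  - have -> : k = i by lia.
    rewrite uij; have -> : (i.+1 + (j - i) = j.+1)%N by lia.
    by apply: uadj; lia.
  - by lia.
  - by rewrite addSn; apply: uadj; lia.
exists u; split => // [i im|i j]; first by apply: uadj; lia.
rewrite !inE => im jm uij; apply: contrapT => /eqP; rewrite neq_ltn => /orP[] h.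
  exact: (uinj _ _ h jm).
exact: (uinj _ _ h im).
Qed.

End Conductance.

(** * The walk killed on [Z] *)

Section Fibers.
Context (R : realType) (d : measure_display) (T : measurableType d).
Context (V : choiceType) (Y : T -> V).
Hypothesis mY : forall v, measurable [set w | Y w = v].
Variable mu : {measure set T -> \bar R}.

Lemma measurable_fibers (D : set V) :
  countable [set: V] -> measurable [set w | D (Y w)].
Proof.
move=> /countable_injP[f finj].
have -> : [set w | D (Y w)] = \bigcup_n [set w | D (Y w) /\ f (Y w) = n].
  by apply/seteqP; split=> [w Dw|w [n _ []]//]; exists (f (Y w)).
apply: bigcupT_measurable => n.
have [[v [Dv fv]]|h] := pselect (exists v, D v /\ f v = n).
  rewrite (_ : mkset _ = [set w | Y w = v])//; apply/seteqP; split=> w /=.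
    by move=> [_ fn]; apply: finj; rewrite ?inE// fn.
  by move=> ->.
rewrite (_ : mkset _ = set0)//; apply/seteqP; split=> // w [Dw fw].
by apply: h; exists (Y w).
Qed.

(** The identity is summed over the countably many fibers inside [D]. It serves with [c] a
    transition probability, and with [c = 0] for null events. *)
Lemma measure_fibers_proportional (D : set V) (A B : set T) (c : R) :
  countable [set: V] -> measurable A -> measurable B ->
  (forall v, D v -> mu (A `&` [set w | Y w = v]) =
                    c%:E * mu (B `&` [set w | Y w = v]))%E ->
  (mu (A `&` [set w | D (Y w)]) = c%:E * mu (B `&` [set w | D (Y w)]))%E.
Proof.
move=> cV mA mB AB; have /countable_injP[f finj] := cV.
pose F n := [set w | D (Y w) /\ f (Y w) = n].
have mF n : measurable (F n).
  exact: (measurable_fibers (fun v => D v /\ f v = n)).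
have split_ E : measurable E -> mu (E `&` [set w | D (Y w)]) =
    (\sum_(n <oo) mu (E `&` F n))%E.
  move=> mE; rewrite -measure_semi_bigcup//; last first.
  - by apply: bigcupT_measurable => n; exact: measurableI.
  - by apply/trivIsetP => i j _ _ ij; apply/seteqP; split=> // w [[_ [_ h1]] [_ [_ h2]]];
      move: ij; rewrite -h1 -h2 eqxx.
  - by move=> n; exact: measurableI.
  congr (mu _); apply/seteqP; split=> w /=; first by move=> [Ew Dw]; exists (f (Y w)).
  by move=> [n _ [Ew [Dw _]]].
rewrite !split_// -nneseriesZl//; apply: eq_eseriesr => n _.
have [[v [Dv fv]]|h] := pselect (exists v, D v /\ f v = n).
  have -> : F n = [set w | Y w = v]; last exact: AB.
  apply/seteqP; split=> w /=; first by move=> [_ fn]; apply: finj; rewrite ?inE// fn.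
  by move=> Yv; rewrite /F/= Yv.
have -> : F n = set0; last by rewrite !setI0 measure0 mule0.
by apply/seteqP; split=> // w [Dw fw]; apply: h; exists (Y w).
Qed.

Lemma measure_fibers_seq (A : set T) (s : seq V) : measurable A -> uniq s ->
  (mu (A `&` [set w | Y w \in s]) =
   \sum_(v <- s) mu (A `&` [set w | Y w = v]))%E.
Proof.
move=> mA; have ms (s' : seq V) : measurable (A `&` [set w | Y w \in s']).
  apply: measurableI => //; elim: s' => [|a s' ih].
    by rewrite (_ : mkset _ = set0)//; apply/seteqP; split.
  rewrite (_ : mkset _ = [set w | Y w = a] `|` [set w | Y w \in s']).
    exact: measurableU.
  apply/seteqP; split=> w /=; rewrite inE; first by move/predU1P.
  by move=> h; apply/predU1P.
elim: s => [|a s ih] /=.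
  rewrite big_nil (_ : _ `&` _ = set0) ?measure0//.
  by apply/seteqP; split=> // w [_] /=; rewrite in_nil.
move=> /andP[as_ us]; rewrite big_cons -ih// -measureU//; last first.
- by apply/seteqP; split=> // w [[_ /= ->] [_]] /=; rewrite (negbTE as_).
- exact: measurableI.
congr (mu _); rewrite -setIUr; congr (_ `&` _).
apply/seteqP; split=> w /=; rewrite inE; first by move/predU1P.
by move=> h; apply/predU1P.
Qed.

End Fibers.

Section KilledWalk.
Context (R : realType) (gamma : R) (gamma_gt0 : 0 < gamma) (S : network R).
Hypothesis bS : bounded_network gamma S.
Hypothesis cS : connected_network S.
Context (d : measure_display) (T : measurableType d) (P : probability T R).
Context (x : vertex S) (X : nat -> T -> vertex S) (Z : set (vertex S)).
Hypothesis wX : random_walk P x X.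
Implicit Types (v : vertex S) (w : T).

(** The event that [tau_Z > t], expressed by the coordinates up to time [t]. *)
Definition alive t : set T := [set w | forall i, (i <= t)%N -> ~ Z (X i w)].

Definition alive_at t v : set T := alive t `&` [set w | X t w = v].

Let cV : countable [set: vertex S].
Proof. exact: (vertex_countable gamma_gt0 bS cS x). Qed.

Let mX t v : measurable [set w | X t w = v].
Proof. exact: rw_measurable wX t v. Qed.

Let mXD t (D : set (vertex S)) : measurable [set w | D (X t w)].
Proof. exact: measurable_fibers. Qed.

Lemma measurable_cylinder (D : nat -> set (vertex S)) t :
  measurable [set w | forall i, (i <= t)%N -> D i (X i w)].
Proof.
have -> : [set w | forall i, (i <= t)%N -> D i (X i w)] =
    \bigcap_i [set w | (fun v => (i <= t)%N -> D i v) (X i w)].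
  by apply/seteqP; split=> w h => [i _|i]; [exact: h|exact: (h i Logic.I)].
by apply: bigcapT_measurable => i; exact: (mXD i (fun v => (i <= t)%N -> D i v)).
Qed.

Lemma measurable_alive t : measurable (alive t).
Proof. exact: (measurable_cylinder (fun=> ~` Z)). Qed.

Lemma measurable_alive_at t v : measurable (alive_at t v).
Proof. by apply: measurableI => //; exact: measurable_alive. Qed.

Hint Resolve measurable_alive measurable_alive_at : core.

(* Pass from cylinders to the event [alive] by freeing the coordinates one at a
   time: those below [j] only have to avoid [Z], the others are prescribed. *)
Lemma markov_partial t j (u : nat -> vertex S) v :
  (j <= t)%N ->
  let D i : set (vertex S) := if (i < j)%N then ~` Z else [set u i] in
  (P ([set w | forall i, (i <= t)%N -> D i (X i w)] `&` [set w | X t.+1 w = v]) =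
   (transition (u t) v)%:E * P [set w | forall i, (i <= t)%N -> D i (X i w)])%E.
Proof.
elim: j u => [|j ih] u jt D.
  (* The prescribed trajectory is continued by [v] at time [t.+1]. *)
  have := rw_step wX t (fun i => if (i <= t)%N then u i else v).
  rewrite leqnn ltnn muleC => h; rewrite /D/=.
  have e1 : [set w | forall i, (i <= t)%N -> X i w = if (i <= t)%N then u i else v]
    = [set w | forall i, (i <= t)%N -> X i w = u i].
    by apply/seteqP; split=> w H i it; have := H i it; rewrite it.
  rewrite e1 in h; rewrite -h; congr (P _); apply/seteqP; split=> w /=.
    move=> [H1 H2] i; rewrite leq_eqVlt => /predU1P[->|]; first by rewrite ltnn.
    by rewrite ltnS => it; rewrite it H1.
  move=> H; split=> [i it|]; last by rewrite H// ltnn.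
  by rewrite H ?it// (leq_trans it).
(* [D'] leaves coordinate [j] free: intersecting [E] with [X j] outside [Z] gives the target event,
   and with [X j = v'] an event of the induction hypothesis. *)
pose D' i : set (vertex S) :=
  if i == j then setT else if (i < j)%N then ~` Z else [set u i].
pose E := [set w | forall i, (i <= t)%N -> D' i (X i w)].
have mE : measurable E by exact: measurable_cylinder.
have DE : [set w | forall i, (i <= t)%N -> D i (X i w)] =
    E `&` [set w | (~` Z) (X j w)].
  apply/seteqP; split=> w /=.
    move=> H; split; last by have := H j (ltnW jt); rewrite /D ltnSn.
    move=> i it; have := H i it; rewrite /D /D' ltnS (leq_eqVlt i j).
    by case: eqVneq.
  move=> [H1 H2] i it; have := H1 i it; rewrite /D /D' ltnS (leq_eqVlt i j).
  by case: eqVneq => [->|].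
have DEv v' : E `&` [set w | X j w = v'] = [set w | forall i, (i <= t)%N ->
    (if (i < j)%N then ~` Z else [set (if i == j then v' else u i)]) (X i w)].
  apply/seteqP; split=> w /=.
    move=> [H1 H2] i it; have := H1 i it; rewrite /D'.
    by case: eqVneq => [-> _|//]; rewrite ltnn.
  move=> H; split=> [i it|]; last by have := H j (ltnW jt); rewrite ltnn eqxx.
  by have := H i it; rewrite /D'; case: eqVneq.
rewrite DE setIAC; apply: measure_fibers_proportional => //.
  exact: measurableI.
move=> v' Zv'; rewrite setIAC !DEv.
(* Only the value at [j] is changed, and [j < t], so the transition out of [u t] stays the same. *)
have := ih (fun i => if i == j then v' else u i) (ltnW jt).
by rewrite /= (gtn_eqF jt).
Qed.

(** This is [markov_partial] with all coordinates before [t] freed. If [v] is in [Z] both sides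
    vanish; otherwise prescribing [X t = v] already makes time [t] avoid [Z]. *)
Lemma alive_markov t v v' :
  (P (alive_at t v `&` [set w | X t.+1 w = v']) =
   (transition v v')%:E * P (alive_at t v))%E.
Proof.
have [Zv|Zv] := pselect (Z v).
  have -> : alive_at t v = set0.
    by apply/seteqP; split=> // w [H1 H2]; apply: (H1 t) => //; rewrite H2.
  by rewrite set0I measure0 mule0.
have := @markov_partial t t (fun=> v) v' (leqnn t) => /=.
rewrite (_ : mkset _ = alive_at t v)//; apply/seteqP; split=> w /=.
  move=> H; split; last by have := H t (leqnn t); rewrite ltnn.
  move=> i it; have := H i it; case: ltnP => // _ ->//.
by move=> [H1 H2] i it; have := H1 i it; case: ltnP => // ti _; rewrite -H2;
  congr (X _ _); lia.
Qed.

(** * Expected visits before hitting [Z], truncated in time *)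

Definition visit t v : R := fine (P (alive_at t v)).

Lemma visitE t v : P (alive_at t v) = (visit t v)%:E.
Proof. by rewrite fineK// fin_num_measure. Qed.

Lemma visit_ge0 t v : 0 <= visit t v.
Proof. by rewrite fine_ge0. Qed.

Lemma sum_visit_le t (s : seq (vertex S)) : uniq s ->
  ((\sum_(v <- s) visit t v)%:E <= P (alive t))%E.
Proof.
move=> us; rewrite -sumEFin; under eq_bigr do rewrite -visitE.
rewrite -measure_fibers_seq//; apply: le_measure; rewrite ?inE//.
by apply: measurableI => //; exact: (mXD t (fun v => v \in s)).
Qed.

(** Condition on the position at time [t]. Only an inequality results, since survival at time [t.+1]
    is dropped: for [v] in [Z] the left side is zero. *)
Lemma visit_step t v : visit t.+1 v <=
  \sum_(v' <- neighbors v) visit t v' * transition v' v.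
Proof.
pose A := alive t `&` [set w | X t.+1 w = v].
have mA : measurable A by exact: measurableI.
have mN D : measurable (A `&` [set w | D (X t w)]).
  by apply: measurableI => //; exact: mXD.
have AX v' : A `&` [set w | X t w = v'] = alive_at t v' `&` [set w | X t.+1 w = v].
  by rewrite /A setIAC.
(* There may be infinitely many non-neighbors; a step from any of them to [v] has probability zero,
   so together they form a null event. *)
have far : P (A `&` [set w | (fun v' => v' \notin neighbors v) (X t w)]) = 0%E.
  rewrite -[RHS](mul0e (P (A `&`
    [set w | (fun v' => v' \notin neighbors v) (X t w)]))).
  apply: (@measure_fibers_proportional _ _ _ _ _ (mX t) P
    (fun v' => v' \notin neighbors v)) => // v' v'v.
  rewrite AX mul0e; apply: etrans (alive_markov t v' v) _.
  by rewrite (transition_not_neighbor gamma_gt0 bS)// mul0e.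
have nearby : (P (A `&` [set w | X t w \in neighbors v]) =
    \sum_(v' <- neighbors v) P (A `&` [set w | X t w = v']))%E.
  by rewrite measure_fibers_seq ?neighbors_uniq.
have mAn := mN (fun v' => v' \in neighbors v).
have mAf := mN (fun v' => v' \notin neighbors v).
have splitA : (P (alive_at t.+1 v) <=
    P (A `&` [set w | X t w \in neighbors v]) +
    P (A `&` [set w | (fun v' => v' \notin neighbors v) (X t w)]))%E.
  apply: le_trans (measureU2 P mAn mAf); apply: le_measure; rewrite ?inE//.
    exact: measurableU.
  move=> w [H1 H2]; have wA : A w.
    by split=> // i it; apply: H1; exact: leq_trans it _.
  by case: (boolP (X t w \in neighbors v)) => h; [left|right].
rewrite -lee_fin -visitE; apply: le_trans splitA _.
rewrite far adde0 nearby -sumEFin lee_sum// => v' _.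
by rewrite AX alive_markov visitE -EFinM mulrC.
Qed.

Definition visits n v : R := \sum_(0 <= t < n) visit t v.

Lemma visits_ge0 n v : 0 <= visits n v.
Proof. by rewrite sumr_ge0// => t _; exact: visit_ge0. Qed.

(** The right side is the expectation of the minimum of [tau_Z] and [n]. *)
Lemma sum_visits_le n (s : seq (vertex S)) : uniq s ->
  ((\sum_(v <- s) visits n v)%:E <= \sum_(0 <= t < n) P (alive t))%E.
Proof.
move=> us; rewrite exchange_big/= -sumEFin; apply: lee_sum => t _.
exact: sum_visit_le.
Qed.

(** Time [0] contributes at most the indicator of [x]; each later time is bounded through the
    preceding one by [visit_step]. *)
Lemma visits_le n v : visits n v <=
  (v == x)%:R + \sum_(v' <- neighbors v) visits n v' * transition v' v.
Proof.
have tr0 v' : 0 <= transition v' v.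
  rewrite transitionE; apply: divr_ge0; last exact/ltW/(weight_gt0 gamma_gt0 bS).
  exact: (conductance_ge0 gamma_gt0 bS).
case: n => [|n].
  rewrite /visits big_geq// addr_ge0// sumr_ge0// => v' _.
  by rewrite big_geq// mul0r.
rewrite /visits big_nat_recl// lerD//.
  have [->|vx] := eqVneq v x.
    by rewrite -lee_fin -visitE probability_le1.
  rewrite -lee_fin -visitE.
  have -> // : P (alive_at 0 v) = 0%E.
  apply/eqP; rewrite -measure_le0; apply: (@le_trans _ _ (P (~` [set w | X 0%N w = x]))).
    apply: le_measure; rewrite ?inE//; first exact: measurableC.
    by move=> w [_ /= ->]; exact/eqP.
  by rewrite probability_setC// (rw_start wX) subee.
under [leRHS]eq_bigr do rewrite mulr_suml.
(* The right side has one time more than the shifted left side; that extra term is nonnegative. *)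
rewrite exchange_big/= [leRHS]big_nat_recr//= ler_wpDr//.
  by rewrite sumr_ge0// => v' _; rewrite mulr_ge0// visit_ge0.
by apply: ler_sum => t _; exact: visit_step.
Qed.

Let u n v : R := visits n v / weight v.

(** If [u] drops from [y] to [z], this edge leaves the superlevel set at height [u n y]. The flow
    bound gives conductance times drop at most [1], and the conductance is at least [gamma]. *)
Lemma visits_gradient n y z : Defs.adjacent y z -> u n y - u n z <= gamma^-1.
Proof.
move=> yz; have w0 := weight_gt0 gamma_gt0 bS.
have u0 v : 0 <= u n v by rewrite divr_ge0 ?visits_ge0// ltW.
have [le_uyz|lt_uzy] := leP (u n y) (u n z).
  by apply: (@le_trans _ _ 0); rewrite ?invr_ge0 ?(ltW gamma_gt0)// subr_le0.
(* The visits during the [n] times before [n] total at most [n], so values of [u n] sum to at most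
   [n / gamma]. *)
have fA : finite_set [set v | u n y <= u n v].
  apply: (finite_set_sum_le (M := n%:R / gamma)); first exact: le_lt_trans lt_uzy.
  move=> s us; apply: (@le_trans _ _ (\sum_(v <- s) visits n v / gamma)).
    apply: ler_sum => v _; rewrite ler_wpM2l ?visits_ge0//.
    have /andP[h _] := weight_bounds gamma_gt0 bS v.
    by rewrite lef_pV2 ?posrE// ltW.
  rewrite -mulr_suml ler_pM2r ?invr_gt0// -lee_fin.
  apply: (le_trans (sum_visits_le n us)).
  rewrite -[n in leRHS]subn0 -sumr_const_nat -sumEFin; apply: lee_sum => t _.
  exact: probability_le1.
have memA v : (v \in finmap.enum_fset (fset_set [set v | u n y <= u n v])) =
    (u n y <= u n v).
  by rewrite in_fset_set//; apply/idP/idP; rewrite inE.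
have : conductance y z * (u n y - u n z) <= 1.
  apply: (superlevel_flow_le1 (p := @weight R S) (N := @neighbors R S) (x := x)
    (A := finmap.enum_fset (fset_set [set v | u n y <= u n v]))).
  - exact: finmap.fset_uniq.
  - exact: conductanceC.
  - exact: (conductance_ge0 gamma_gt0 bS).
  - exact: (sum_conductance_le gamma_gt0 bS).
  - exact: u0.
  - exact: neighbors_uniq.
  (* Reversibility: weight times transition probability is the symmetric conductance, which turns
     [visits_le] into an inequality for [u]. *)
  - move=> v; rewrite mulrC divfK ?gt_eqF//; apply: (le_trans (visits_le n v)).
    rewrite lerD2l; apply: ler_sum => v' _.
    by rewrite /u transitionE conductanceC mulrCA mulrA mulrAC.
  - by move=> v v'; rewrite !memA -ltNge => h1 /ltW h2; exact: le_trans h2 h1.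
  - by rewrite memA.
  - by rewrite memA -ltNge.
move=> h; rewrite -[leRHS]mul1r ler_pdivlMr// mulrC; apply: le_trans h.
rewrite ler_wpM2r ?subr_ge0 ?(ltW lt_uzy)//.
exact: (conductance_adjacent gamma_gt0 bS).
Qed.

(** * Quadratic lower bound along a geodesic *)

Hypothesis iS : infinite_network S.

Lemma sum_alive_ge n :
  ((gamma ^+ 4 / 4 * visits n x ^+ 2)%:E <= \sum_(0 <= t < n) P (alive t))%E.
Proof.
have w0 := weight_gt0 gamma_gt0 bS.
set U := u n x.
have U0 : 0 <= U by rewrite divr_ge0 ?visits_ge0// ltW.
have hU : gamma * visits n x <= U.
  rewrite mulrC ler_wpM2l ?visits_ge0//.
  have /andP[_ h] := weight_bounds gamma_gt0 bS x.
  by rewrite -[leLHS]invrK lef_pV2 ?posrE ?invr_gt0// ltW.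
(* Losing at most [1 / gamma] per step, [u] stays at least [U / 2] for [m] steps. The path has
   [m.+1 > gamma * U / 2] vertices with at least [gamma * (U / 2)] visits each; [hU] then supplies
   the remaining [gamma ^+ 2]. *)
pose m := Num.truncn (gamma * U / 2).
have gU0 : 0 <= gamma * U / 2.
  by rewrite divr_ge0// mulr_ge0// ltW.
have /andP[m1 m2] := truncn_itv gU0.
have [p [p0 padj pinj]] := exists_geodesic gamma_gt0 bS cS iS x m.
have pu i : (i <= m)%N -> U - i%:R / gamma <= u n (p i).
  elim: i => [|i ih] im; first by rewrite p0 mul0r subr0.
  have := visits_gradient n (padj i im).
  have := ih (ltnW im); rewrite -natr1 mulrDl mul1r; lra.
pose s := [seq p i | i <- iota 0 m.+1].
have us : uniq s.
  rewrite map_inj_in_uniq ?iota_uniq// => i j.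
  by rewrite !mem_iota !add0n !ltnS => /= im jm; exact: pinj.
apply: le_trans (sum_visits_le n us); rewrite lee_fin big_map.
apply: (@le_trans _ _ (\sum_(i <- iota 0 m.+1) gamma * (U / 2))); last first.
  rewrite big_seq [leRHS]big_seq; apply: ler_sum => i.
  rewrite mem_iota add0n ltnS => /= im.
  have -> : visits n (p i) = weight (p i) * u n (p i).
    by rewrite mulrC divfK// gt_eqF.
  have /andP[h _] := weight_bounds gamma_gt0 bS (p i).
  have U2 : 0 <= U / 2 by rewrite mulr_ge0.
  apply: ler_pM; rewrite ?(ltW gamma_gt0) ?(ltW h) ?U2//.
  apply: le_trans (pu i im).
  have : i%:R / gamma <= U / 2.
    rewrite ler_pdivrMr// mulrC mulrA; apply: le_trans m1.
    by rewrite ler_nat.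
  lra.
rewrite big_const_seq iter_addr addr0 count_predT size_iota.
rewrite -[leRHS]mulr_natl; apply: (@le_trans _ _ (gamma * U / 2 * (gamma * (U / 2)))).
  have -> : gamma * U / 2 * (gamma * (U / 2)) = gamma ^+ 2 / 4 * U ^+ 2 by field.
  have -> : gamma ^+ 4 / 4 * visits n x ^+ 2 =
    gamma ^+ 2 / 4 * (gamma * visits n x) ^+ 2 by field.
  rewrite ler_wpM2l ?divr_ge0 ?sqr_ge0//.
  by rewrite lerXn2r ?nnegrE// mulr_ge0 ?visits_ge0// ltW.
by rewrite ler_wpM2r ?(ltW m2)// mulr_ge0 ?(ltW gamma_gt0)// mulr_ge0.
Qed.

(** * Hitting time and Green function as series *)

Lemma hitting_time_ge t w : alive t w -> (t.+1%:R%:E <= hitting_time X Z w)%E.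
Proof.
move=> H; apply/ereal_infP => _ [s Zs <-].
rewrite lee_fin ler_nat ltnNge; apply/negP => st; exact: H Zs.
Qed.

Lemma hitting_timeE w :
  hitting_time X Z w = (\sum_(t <oo) (\1_(alive t) w)%:E)%E.
Proof.
have alive_sum m : (forall t, (t < m)%N -> alive t w) ->
    (\sum_(0 <= t < m) (\1_(alive t) w)%:E = m%:R%:E :> \bar R)%E.
  move=> H; rewrite big_mkord (eq_bigr (fun=> 1%:E)); last first.
    by move=> [t tm] _; rewrite indicE mem_set//; exact: H.
  by rewrite sumEFin big_const_ord iter_addr addr0.
have [hit|nohit] := pselect (exists t, Z (X t w)).
  have hitb : exists t, `[< Z (X t w) >] by case: hit => t ?; exists t; exact/asboolP.
  case: (ex_minnP hitb) => m /asboolP Zm mmin.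
  have al t : (t < m)%N -> alive t w.
    move=> tm i it Zi; have := mmin i (asboolT Zi); lia.
  rewrite (nneseries_split 0 m)// add0n alive_sum//.
  rewrite eseries0 ?adde0; last first.
    by move=> t mt _; rewrite indicE memNset// => /(_ m mt).
  apply/eqP; rewrite eq_le; apply/andP; split.
    by apply: ereal_inf_lbound; exists m.
  apply/ereal_infP => _ [s Zs <-].
  by rewrite lee_fin ler_nat; apply: mmin; exact/asboolP.
have al t : alive t w by move=> i _ Zi; apply: nohit; exists i.
(* The infimum of the empty set is [+oo], matched by partial sums that grow without bound. *)
rewrite /hitting_time (_ : [set _ | _ in _] = set0); last first.
  by apply/seteqP; split=> [y [t Zt _]|//]; apply: nohit; exists t.
rewrite ereal_inf0; apply/esym/eqyP => r r0.
apply: (@le_trans _ _ (Num.truncn r).+1%:R%:E).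
  by rewrite lee_fin ltW// truncnS_gt.
by rewrite -alive_sum//; apply: nneseries_lim_ge.
Qed.

Lemma expected_hitting_timeE :
  expected_hitting_time P X Z = (\sum_(t <oo) P (alive t))%E.
Proof.
rewrite /expected_hitting_time; under eq_integral do rewrite hitting_timeE.
rewrite integral_nneseries//; last first.
  by move=> t; apply/measurable_EFinP; exact: measurable_indic.
by apply: eq_eseriesr => t _; rewrite integral_indic// setIT.
Qed.

Hypothesis nZx : ~ Z x.

(** [green] also counts time [tau_Z], which [alive_at] excludes. The two agree because the walk is
    then in [Z], while [x] is not. *)
Lemma greenE : green P X Z x = (\sum_(t <oo) (visit t x)%:E)%E.
Proof.
rewrite /green.
have E w : (\sum_(t <oo | (t%:R%:E <= hitting_time X Z w)%E)
     (\1_[set x] (X t w))%:E = \sum_(t <oo) (\1_(alive_at t x) w)%:E :> \bar R)%E.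
  rewrite eseries_mkcond; apply: eq_eseriesr => t _; rewrite !indicE.
  have [Xt|Xt] := eqVneq (X t w) x; last first.
    rewrite !memNset//; first by case: ifP.
      by move=> [_ /= h]; rewrite h eqxx in Xt.
    by move=> /= h; rewrite h eqxx in Xt.
  rewrite Xt [_ \in [set x]]mem_set//; case: ifPn => tt.
    rewrite mem_set//; split=> // i; rewrite leq_eqVlt => /predU1P[->|it].
      by rewrite Xt.
    move=> Zi; have : (hitting_time X Z w <= i%:R%:E)%E.
      by apply: ereal_inf_lbound; exists i.
    by move=> /(le_trans tt); rewrite lee_fin ler_nat leqNgt it.
  rewrite memNset// => -[/hitting_time_ge h _]; move/negP: tt; apply.
  by apply: le_trans h; rewrite lee_fin ler_nat.
under eq_integral do rewrite E.
rewrite integral_nneseries//; last first.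
  by move=> t; apply/measurable_EFinP; exact: measurable_indic.
by apply: eq_eseriesr => t _; rewrite integral_indic// setIT; exact: visitE.
Qed.

Lemma visits_le_green n : ((visits n x)%:E <= green P X Z x)%E.
Proof.
rewrite greenE /visits -sumEFin; apply: nneseries_lim_ge => t _ _.
by rewrite lee_fin visit_ge0.
Qed.

Lemma green_le (K : R) : (forall n, visits n x <= K) -> (green P X Z x <= K%:E)%E.
Proof.
move=> H; rewrite greenE; apply: lime_le.
  by apply: is_cvg_nneseries => t _ _; rewrite lee_fin visit_ge0.
by apply: nearW => n; rewrite sumEFin lee_fin; exact: H.
Qed.

(** A finite mean hitting time bounds [visits n x] uniformly in [n] by [sum_alive_ge], and the bound
    passes to the limit. *)
Lemma green_sqr_le : (expected_hitting_time P X Z < +oo)%E ->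
  (green P X Z x < +oo)%E /\
  ((gamma ^+ 4 / 4 * fine (green P X Z x) ^+ 2)%:E <=
   expected_hitting_time P X Z)%E.
Proof.
have E0 : (0 <= expected_hitting_time P X Z)%E.
  by rewrite expected_hitting_timeE; exact: nneseries_ge0.
case EM : (expected_hitting_time P X Z) E0 => [M| |]// M0 _.
have c0 : 0 < gamma ^+ 4 / 4 by rewrite divr_gt0 ?exprn_gt0.
have H n : visits n x <= Num.sqrt (M / (gamma ^+ 4 / 4)).
  rewrite -[leLHS]ger0_norm ?visits_ge0// -sqrtr_sqr ler_wsqrtr//.
  rewrite ler_pdivlMr// mulrC -lee_fin -EM expected_hitting_timeE.
  by apply: (le_trans (sum_alive_ge n)); apply: nneseries_lim_ge.
have /green_le GK := H.
have G0 : (0 <= green P X Z x)%E.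
  by apply: le_trans (visits_le_green 0); rewrite lee_fin visits_ge0.
split; first exact: le_lt_trans GK (ltry _).
case: (green P X Z x) GK G0 => [G| |]//=; rewrite !lee_fin => GK G0.
rewrite mulrC -ler_pdivlMr//.
rewrite -[leRHS]sqr_sqrtr ?(divr_ge0 M0 (ltW c0))//.
by rewrite lerXn2r ?nnegrE// sqrtr_ge0.
Qed.

(** The product is the probability of the cylinder along [p], which lies inside
    [alive_at t (p t)]. *)
Lemma visit_path (p : nat -> vertex S) t : p 0%N = x ->
  (forall i, (i <= t)%N -> ~ Z (p i)) ->
  \prod_(0 <= i < t) transition (p i) (p i.+1) <= visit t (p t).
Proof.
move=> p0 Zp.
have -> : \prod_(0 <= i < t) transition (p i) (p i.+1) =
    fine (P [set w | forall i, (i <= t)%N -> X i w = p i]).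
  elim: t {Zp} => [|t ih].
    rewrite big_geq// (_ : [set w | _] = [set w | X 0%N w = x]) ?(rw_start wX)//.
    by apply/seteqP; split=> w /=; [move/(_ 0%N); rewrite p0; apply|move=> h [|//]; rewrite p0].
  rewrite big_nat_recr//= ih (rw_step wX) fineM// fin_num_measure//.
  exact: (measurable_cylinder (fun i => [set p i])).
rewrite fine_le ?fin_num_measure//.
- exact: (measurable_cylinder (fun i => [set p i])).
apply: le_measure; rewrite ?inE//.
  exact: (measurable_cylinder (fun i => [set p i])).
by move=> w H; split=> [i it|]; rewrite /= H//; exact: Zp.
Qed.

(** The [1] comes from time [0], and [gamma ^+ 4] from the excursion [x], [y], [x] ending at time
    [2]. *)
Lemma green_ge (y : vertex S) : Defs.adjacent x y -> ~ Z y ->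
  ((1 + gamma ^+ 4)%:E <= green P X Z x)%E.
Proof.
move=> xy nZy; apply: le_trans (visits_le_green 3); rewrite lee_fin /visits.
rewrite !big_nat_recr// big_geq//= add0r.
have v0 : 1 <= visit 0 x.
  have := @visit_path (fun=> x) 0 erefl (fun i _ => nZx).
  by rewrite big_geq.
have v2 : gamma ^+ 4 <= visit 2 x.
  have := @visit_path (fun i => if odd i then y else x) 2 erefl.
  rewrite !big_nat_recr// big_geq//= mul1r; move=> h.
  apply: le_trans (h _) => [|i _]; last by case: ifP.
  rewrite (_ : 4%N = (2 + 2)%N)// exprD ler_pM ?exprn_ge0 ?(ltW gamma_gt0)//.
    exact: (transition_ge gamma_gt0 bS).
  exact/(transition_ge gamma_gt0 bS)/adjacentC.
by rewrite lerD// ler_wpDr// visit_ge0.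
Qed.

End KilledWalk.

(** * From the quadratic bound to the theorem *)

Lemma walk_between_Ball (R : realType) (S : network R) (x y : vertex S)
    (n : nat) (r : R) : walk_between n y x -> n%:R < r -> Ball r x y.
Proof.
move=> ny nr; rewrite /Ball /=; apply: (@le_lt_trans _ _ n%:R%:E).
  by apply: ereal_inf_lbound; exists n.
by rewrite lte_fin.
Qed.

Lemma exists_neighbor (R : realType) (S : network R) (x : vertex S) :
  infinite_network S -> connected_network S -> exists y, Defs.adjacent x y.
Proof.
move=> iS cS; apply: contrapT => h; apply: iS.
apply: sub_finite_set (finite_set1 x) => y _ /=.
have [[|n] [u [u0 un uadj]]] := cS x y; first by rewrite -un.
by case: h; exists (u 1%N); rewrite -u0; exact: uadj.
Qed.

Theorem lemma6p1 (R : realType) (gamma : R) (gamma_gt0 : 0 < gamma) :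
  exists k : R, 0 < k /\
    forall S : network R,
      infinite_network S -> connected_network S -> bounded_network gamma S ->
    forall (x : vertex S) (Z : set (vertex S)), Ball 2 x `&` Z = set0 ->
    forall (d : measure_display) (T : measurableType d) (P : probability T R)
           (X : nat -> T -> vertex S), random_walk P x X ->
      let G := green P X Z x in
      let Etau := expected_hitting_time P X Z in
      (G = +oo%E -> Etau = +oo%E) /\
      ((G < +oo)%E -> ((k * (fine G ^+ 2 / ln (fine G)))%:E < Etau)%E).
Proof.
set c := gamma ^+ 4 / 4; set L := ln (1 + gamma ^+ 4).
have g4 : 0 < gamma ^+ 4 by rewrite exprn_gt0.
have c0 : 0 < c by rewrite divr_gt0.
have L0 : 0 < L by rewrite ln_gt0// ltrDl.
(* [L] is a lower bound for the logarithm of [G], by [green_ge]; the factor [1 / 2] makes the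
   inequality strict. *)
exists (c * L / 2); split; first by rewrite divr_gt0// mulr_gt0.
move=> S iS cS bS x Z BZ d T P X wX G Etau.
have nZ v n : walk_between n v x -> (n < 2)%N -> ~ Z v.
  move=> vx n2 Zv; suff : (Ball 2 x `&` Z) v by rewrite BZ.
  by split=> //; apply: walk_between_Ball vx _; rewrite ltr_nat.
have nZx : ~ Z x by apply: (nZ x 0%N) => //; exists (fun=> x).
have [y xy] := exists_neighbor x iS cS.
have nZy : ~ Z y.
  apply: (nZ y 1%N) => //; exists (fun i => if i is 0%N then y else x); split=> //.
  by case=> // _; exact: adjacentC.
have Gge : ((1 + gamma ^+ 4)%:E <= G)%E := green_ge gamma_gt0 bS cS wX nZx xy nZy.
have [E_oo|/eqP E_oo] := eqVneq Etau +oo%E.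
  by split=> // _; rewrite E_oo ltry.
have [Goo GE] : (G < +oo)%E /\ ((c * fine G ^+ 2)%:E <= Etau)%E.
  by apply: (green_sqr_le gamma_gt0 bS cS wX iS nZx); rewrite ltey; exact/eqP.
split=> [h|_]; first by rewrite h in Goo.
apply: lt_le_trans GE; rewrite lte_fin.
move: Goo Gge; case: G => [g| |]//= _; rewrite lee_fin => Gge.
have lnL : L <= ln g by rewrite ler_ln// posrE; lra.
have g0 : 0 < g by lra.
(* Since [L <= ln g], the last factor is at most [1 / 2]. *)
have -> : c * L / 2 * (g ^+ 2 / ln g) = c * g ^+ 2 * (L / ln g / 2) by ring.
rewrite gtr_pMr ?mulr_gt0 ?exprn_gt0//.
rewrite ltr_pdivrMr// mul1r ltr_pdivrMr ?(lt_le_trans L0)//; lra.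
Qed.
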